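(* The monad $P$ of probability measures on the category $\mathbf{QBS}$ of quasi-Borel spaces satisfies the following properties. 1. For a morphism $f\colon(X,M_X)\to(Y,M_Y)$, the functorial action $P(f)\colon P(X)\to P(Y)$ is $[\alpha,\mu]\mapsto[f\circ\alpha,\mu]$. 2. $P$ is a commutative monad: if $p\in P(X)$, $q\in P(Y)$, and $f$ is a morphism $X\times Y\to P(Z)$, then $$p\gg\!=\lambda x.\,(q\gg\!=\lambda y.\,f(x,y))\;=\;q\gg\!=\lambda y.\,(p\gg\!=\lambda x.\,f(x,y)).$$ 3. The faithful functor $L\colon\mathbf{QBS}\to\mathbf{Meas}$ with $L(X,M_X)=(X,\Sigma_{M_X})$ (identity on underlying functions) extends to a faithful functor $\mathsf{Kleisli}(P)\to\mathsf{Kleisli}(G)$, i.e. $(L,l)$ is a monad opfunctor from $P$ to the Giry monad $G$, where $l_X\colon L(P(X))\to G(X,\Sigma_{M_X})$ is $l_X([\alpha,\mu])=\alpha_*\mu$. 4. When $(X,\Sigma_X)$ is a standard Borel space, regarded as a quasi-Borel space with $M_X$ the set of measurable functions $\mathbb{R}\to X$, the map $l_X$ is a measurable isomorphism.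
   Context: A quasi-Borel space is a set $X$ together with a set $M_X$ of functions $\mathbb{R}\to X$ such that: (i) $\alpha\circ f\in M_X$ whenever $\alpha\in M_X$ and $f\colon\mathbb{R}\to\mathbb{R}$ is (Borel) measurable; (ii) every constant function $\mathbb{R}\to X$ is in $M_X$; (iii) if $\mathbb{R}=\biguplus_{i\in\mathbb{N}}S_i$ with each $S_i$ Borel and $\alpha_i\in M_X$ for each $i$, then $\beta\in M_X$, where $\beta(r)=\alpha_i(r)$ for $r\in S_i$. A morphism $(X,M_X)\to(Y,M_Y)$ is a function $f\colon X\to Y$ with $f\circ\alpha\in M_Y$ for all $\alpha\in M_X$; these form the category $\mathbf{QBS}$. Products are product sets with $M_{X\times Y}=\{f\mid\pi_1\circ f\in M_X,\ \pi_2\circ f\in M_Y\}$. $\mathbf{Meas}$ is the category of measurable spaces and measurable functions. A standard Borel space is a measurable space that is either measurably isomorphic to $\mathbb{R}$ with its Borel sets, or countable and discrete. $\Sigma_{M_X}=\{U\subseteq X\mid\forall\alpha\in M_X.\ \alpha^{-1}(U)\text{ is Borel}\}$, a $\sigma$-algebra on $X$; for a standard Borel space $(X,\Sigma_X)$ with $M_X$ the measurable functions $\mathbb{R}\to X$ one has $\Sigma_{M_X}=\Sigma_X$. For a measurable space $Z$, $G(Z)$ is the set of probability measures on $Z$ with the $\sigma$-algebra generated by the sets $\{\mu\mid\mu(U)<r\}$ for $U$ measurable and $r\in[0,1]$; $G$ is the Giry monad on $\mathbf{Meas}$, with Dirac measures as unit and bind $(\mu\gg\!=_G k)(U)=\int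 k(x)(U)\,\mathrm{d}\mu(x)$ for measurable $k\colon Z\to G(Z')$. A probability measure on $(X,M_X)$ is a pair $(\alpha,\mu)$ with $\alpha\in M_X$ and $\mu$ a Borel probability measure on $\mathbb{R}$. Write $(\alpha,\mu)\sim(\alpha',\mu')$ if $\alpha_*\mu=\alpha'_*\mu'$ as measures on $(X,\Sigma_{M_X})$, and $[\alpha,\mu]$ for the equivalence class. The monad $P$: $P(X)$ is the set of probability measures on $(X,M_X)$ modulo $\sim$, with $M_{P(X)}$ the set of $\beta\colon\mathbb{R}\to P(X)$ for which there exist $\alpha\in M_X$ and a measurable $g\colon\mathbb{R}\to G(\mathbb{R})$ with $\beta(r)=[\alpha,g(r)]$ for all $r$. The unit is $\eta_X(x)=[\lambda r.\,x,\mu]$ for an arbitrary probability measure $\mu$ on $\mathbb{R}$. Bind: for a morphism $f\colon X\to P(Y)$ and $[\alpha,\mu]\in P(X)$, pick a measurable $g\colon\mathbb{R}\to G(\mathbb{R})$ and $\beta\in M_Y$ with $(f\circ\alpha)(r)=[\beta,g(r)]$ for all $r$, and set $([\alpha,\mu]\gg\!=f)=[\beta,\mu\gg\!=_G g]$. The functorial action of a monad given in this form is $P(f)(t)=(t\gg\!=\eta\circ f)$. That $(L,l)$ is a monad opfunctor means that the $l_X$ are measurable and compatible with the monad structures: $l_X\circ L(\eta_X)=\eta^G_{L X}$, and $l_Y(t\gg\!=f)=(l_X(t)\gg\!=_G(l_Y\circ f))$ for every morphism $f\colon X\to P(Y)$ and $t\in P(X)$; the induced functor between Kleisli categories sends $f\colon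 X\to P(Y)$ to $l_Y\circ L(f)\colon L(X)\to G(L(Y))$. *)

(* Defs.v *)
From HB Require Import structures.
From mathcomp Require Import all_boot all_order all_algebra.
From mathcomp Require Import generic_quotient ring lra.
From mathcomp Require Import all_classical all_reals all_analysis.
From mathcomp Require Import measurable_realfun lebesgue_measure giry.

Set Implicit Arguments.
Unset Strict Implicit.
Unset Printing Implicit Defensive.

Import Order.TTheory GRing.Theory Num.Theory.
Import numFieldNormedType.Exports.

Local Open Scope classical_set_scope.
Local Open Scope quotient_scope.
Local Open Scope ring_scope.

(* The library's [measurableType] is pointed, whereas the empty space is an
   object of both QBS and Meas (and the empty set is a countable discrete
   space).  Hence the objects of Meas are arbitrary types with a sigma-algebra;
   [mtype] below recovers the library structure on inhabited ones. *)

Record mspace := MSpace {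
  mcarrier :> Type;
  msets : set (set mcarrier);
  msets_sigma_algebra : sigma_algebra setT msets }.

Record mhom (Z Z' : mspace) := MHom {
  mfunction :> Z -> Z';
  mfunctionP : forall U, msets U -> msets (mfunction @^-1` U) }.

Definition mspace_of (d : measure_display) (T : measurableType d) : mspace :=
  MSpace (@sigma_algebra_measurable d T).

Section mspace_theory.
Implicit Types Z : mspace.

Lemma msets0 Z : msets (set0 : set Z).
Proof. by case: (msets_sigma_algebra Z). Qed.

Lemma msetsC Z (A : set Z) : msets A -> msets (~` A).
Proof. by case: (msets_sigma_algebra Z) => _ + _ => /[apply]; rewrite setTD. Qed.

Lemma msets_bigcup Z (F : (set Z)^nat) :
  (forall i, msets (F i)) -> msets (\bigcup_i F i).
Proof. by case: (msets_sigma_algebra Z) => _ _; exact. Qed.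

Lemma msetsT Z : msets [set: Z].
Proof. by rewrite -setC0; apply/msetsC/msets0. Qed.

Lemma msetsI Z (A B : set Z) : msets A -> msets B -> msets (A `&` B).
Proof.
move=> mA mB; rewrite -[A `&` B]setCK setCI; apply: msetsC.
rewrite -bigcup2E; apply: msets_bigcup => -[|[|i]] /=.
- exact: msetsC.
- exact: msetsC.
- exact: msets0.
Qed.

Lemma mhomP Z Z' (f g : mhom Z Z') : f =1 g -> f = g.
Proof.
case: f g => [f fP] [g gP] /= /funext fg.
by move: gP; rewrite -fg => gP; congr MHom; exact: Prop_irrelevance.
Qed.

Definition mid Z : mhom Z Z := @MHom Z Z id (fun U mU => mU).

Definition mcomp Z1 Z2 Z3 (g : mhom Z2 Z3) (f : mhom Z1 Z2) : mhom Z1 Z3 :=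
  @MHom Z1 Z3 (g \o f) (fun U mU => mfunctionP f (mfunctionP g mU)).

Definition measurable_map (Z Z' : mspace) (f : Z -> Z') : Prop :=
  forall U, msets U -> msets (f @^-1` U).

Definition measurable_iso (Z Z' : mspace) (f : Z -> Z') : Prop :=
  measurable_map f /\
  exists g : Z' -> Z, [/\ measurable_map g, cancel f g & cancel g f].

End mspace_theory.

Definition inhabited_point (T : Type) (H : inhabited T) : T :=
  projT1 (cid (let: inhabits x := H in ex_intro (fun=> True) x I)).

Definition mtype (Z : mspace) (H : inhabited Z) : Type := Z.

Section mtype_instances.
Variables (Z : mspace) (H : inhabited Z).

HB.instance Definition _ := gen_eqMixin (mtype H).
HB.instance Definition _ := gen_choiceMixin (mtype H).
HB.instance Definition _ := isPointed.Build (mtype H) (inhabited_point H).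
HB.instance Definition _ := @isMeasurable.Build default_measure_display
  (mtype H) (@msets Z) (@msets0 Z) (@msetsC Z) (@msets_bigcup Z).

End mtype_instances.

Definition borel (R : realType) : mspace := mspace_of R.

(* Values outside the sigma-algebra are fixed to be 0, so that Leibniz equality
   of measures is equality on the measurable sets. *)
Record gprob (R : realType) (Z : mspace) := GProb {
  gmeas :> set Z -> \bar R;
  gmeas_out : forall U, ~ msets U -> gmeas U = 0%E;
  gmeas0 : gmeas set0 = 0%E;
  gmeas_ge0 : forall U, (0 <= gmeas U)%E;
  gmeas_sigma_additive : forall F : (set Z)^nat,
    (forall i, msets (F i)) -> trivIset setT F ->
    (fun n => \sum_(0 <= i < n) gmeas (F i))%E @ \oo --> gmeas (\bigcup_n F n);
  gmeasT : gmeas setT = 1%E }.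

Section Giry.
Variable R : realType.
Implicit Types Z : mspace.

Lemma gprobP Z (m1 m2 : gprob R Z) :
  (forall U, msets U -> m1 U = m2 U) -> m1 = m2.
Proof.
move=> e; have {}e : gmeas m1 = gmeas m2.
  by apply/funext => U; have [/e//|nU] := pselect (msets U); rewrite !gmeas_out.
case: m1 m2 e => [f a1 a2 a3 a4 a5] [g b1 b2 b3 b4 b5] /= fg.
by subst g; congr GProb; exact: Prop_irrelevance.
Qed.

Definition Giry_gen Z : set (set (gprob R Z)) :=
  [set A | exists (U : set Z) (r : R),
    [/\ msets U, 0 <= r <= 1 & A = [set mu : gprob R Z | (mu U < r%:E)%E]]].

Definition Giry Z : mspace :=
  MSpace (smallest_sigma_algebra setT (@Giry_gen Z)).

Lemma gprob_inhabited Z (mu : gprob R Z) : inhabited Z.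
Proof.
apply: contrapT => H; have := gmeasT mu.
rewrite (_ : setT = set0) ?gmeas0; last first.
  by apply/seteqP; split => // x _; case: H.
by move=> /esym/eqP; rewrite onee_eq0.
Qed.

Section to_probability.
Variables (Z : mspace) (H : inhabited Z) (mu : gprob R Z).

Definition gpr (U : set (mtype H)) : \bar R := mu U.

Let gpr0 : gpr set0 = 0%E. Proof. exact: gmeas0. Qed.
Let gpr_ge0 U : (0 <= gpr U)%E. Proof. exact: gmeas_ge0. Qed.
Let gpr_sadd : semi_sigma_additive gpr.
Proof. by move=> F mF tF _; exact: gmeas_sigma_additive. Qed.
Let gprT : gpr setT = 1%E. Proof. exact: gmeasT. Qed.

HB.instance Definition _ := isMeasure.Build _ _ _ gpr gpr0 gpr_ge0 gpr_sadd.
HB.instance Definition _ := Measure_isProbability.Build _ _ _ gpr gprT.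

End to_probability.
#[local] Arguments gpr {Z} H mu U.

Section of_probability.
Variables (Z : mspace) (H : inhabited Z) (P : probability (mtype H) R).

Definition gprob_of_fun (U : set Z) : \bar R :=
  if `[< msets U >] then P U else 0%E.

Let gE U : msets U -> gprob_of_fun U = P U.
Proof. by rewrite /gprob_of_fun => mU; case: asboolP. Qed.

Let g_out U : ~ msets U -> gprob_of_fun U = 0%E.
Proof. by rewrite /gprob_of_fun; case: asboolP. Qed.

Let g0 : gprob_of_fun set0 = 0%E.
Proof. by rewrite gE ?measure0//; exact: msets0. Qed.

Let g_ge0 U : (0 <= gprob_of_fun U)%E.
Proof. by rewrite /gprob_of_fun; case: ifPn. Qed.

Let g_sadd (F : (set Z)^nat) : (forall i, msets (F i)) -> trivIset setT F ->
  (fun n => \sum_(0 <= i < n) gprob_of_fun (F i))%E @ \oo -->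
    gprob_of_fun (\bigcup_n F n).
Proof.
move=> mF tF; rewrite gE; last exact: msets_bigcup.
under eq_fun do under eq_bigr do rewrite gE//.
by apply: (@measure_semi_sigma_additive _ _ _ P) => //; exact: msets_bigcup.
Qed.

Let gT : gprob_of_fun setT = 1%E.
Proof. by rewrite gE ?probability_setT//; exact: msetsT. Qed.

Definition gprob_of : gprob R Z := GProb g_out g0 g_ge0 g_sadd gT.

Lemma gprob_ofE U : msets U -> gprob_of U = P U. Proof. exact: gE. Qed.

End of_probability.

(* A space carrying a probability measure is inhabited, so that the library
   integral on [mtype] applies. *)
Definition gint Z (mu : gprob R Z) (f : Z -> \bar R) : \bar R :=
  let H := gprob_inhabited mu in
  (\int[gpr H mu]_(x in [set: mtype H]) f x)%E.

Lemma gintE Z (H : inhabited Z) (mu : gprob R Z) (f : Z -> \bar R) :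
  gint mu f = (\int[gpr H mu]_(x in [set: mtype H]) f x)%E.
Proof. by rewrite /gint (Prop_irrelevance (gprob_inhabited mu) H). Qed.

Lemma measurable_gev Z (mU : set Z) : msets mU ->
  forall V : set (\bar R), measurable V ->
  @msets (Giry Z) [set mu : gprob R Z | V (mu mU)].
Proof.
move=> mU0.
case: (pselect (inhabited (gprob R Z))) => [H|H]; last first.
  move=> V _; rewrite (_ : [set _ | _] = set0); first exact: msets0.
  by apply/seteqP; split => // x _; case: H.
suff h : measurable_fun [set: @mtype (Giry Z) H]
    ((fun mu : gprob R Z => mu mU) : @mtype (Giry Z) H -> \bar R).
  by move=> V /(h measurableT); rewrite setTI.
apply: (measurability (@ErealGenInftyO.G R)).
  exact: ErealGenInftyO.measurableE.
move=> _ [_ [r ->] <-]; rewrite setTI.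
rewrite (_ : _ @^-1` _ = [set mu : gprob R Z | (mu mU < r%:E)%E]); last first.
  by apply/seteqP; split => mu /=; rewrite in_itv.
have [r0|r0] := ltP r 0.
  rewrite (_ : [set _ | _] = set0); first exact: measurable0.
  apply/seteqP; split => // mu /= h.
  by have := le_lt_trans (gmeas_ge0 mu mU) h; rewrite lte_fin ltNge (ltW r0).
have [r1|r1] := ltP 1 r.
  rewrite (_ : [set _ | _] = setT); first exact: measurableT.
  apply/seteqP; split => // mu _ /=.
  have Hz := gprob_inhabited mu.
  have := @probability_le1 _ _ _ (gpr Hz mu) mU mU0.
  by move/le_lt_trans; apply; rewrite lte_fin.
by apply: sub_sigma_algebra; exists mU, r; rewrite r0 r1.
Qed.

Lemma measurable_to_Giry (Z Z' : mspace) (k : Z -> gprob R Z') :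
  (forall U, msets U -> forall V : set (\bar R), measurable V ->
    msets [set z | V (k z U)]) ->
  @measurable_map Z (Giry Z') k.
Proof.
move=> h A mA.
pose G := [set A : set (gprob R Z') | msets (k @^-1` A)].
have sG : sigma_algebra setT G.
  split; rewrite /G /=.
  - by rewrite preimage_set0; exact: msets0.
  - by move=> B; rewrite setTD preimage_setC; exact: msetsC.
  - by move=> F mF; rewrite preimage_bigcup; exact: msets_bigcup.
apply: (mA G); split => // _ [U [r [mU _ ->]]].
have := h U mU `]-oo, r%:E[%classic (emeasurable_itv _).
by congr msets; apply/seteqP; split => z /=; rewrite in_itv.
Qed.

Lemma measurable_gev_comp (Z Z' : mspace) (k : mhom Z (Giry Z')) (U : set Z') :
  msets U -> forall H : inhabited Z,
  measurable_fun [set: mtype H] (fun z : mtype H => k z U).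
Proof.
move=> mU H _ V mV; rewrite setTI.
exact: (mfunctionP k (measurable_gev mU mV)).
Qed.

Definition gdirac Z (x : Z) : gprob R Z :=
  gprob_of (dirac (x : mtype (inhabits x)) : probability _ R).

Lemma gdiracE Z (x : Z) U : msets U -> gdirac x U = (\1_U x)%:E.
Proof. by move=> mU; rewrite gprob_ofE. Qed.

Lemma measurable_gdirac Z : @measurable_map Z (Giry Z) (@gdirac Z).
Proof.
apply: measurable_to_Giry => U mU V mV.
have -> : [set z | V (gdirac z U)] = [set z | V (\1_U z)%:E].
  by apply/funext => z; rewrite /mkset gdiracE.
rewrite (_ : [set z | _] = (U `&` [set _ | V 1%:E]) `|` (~` U `&` [set _ | V 0%:E])).
  have mcst (P : Prop) : msets [set _ : Z | P].
    have [p|p] := pselect P.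
      rewrite (_ : [set _ | _] = setT); first exact: msetsT.
      by apply/seteqP; split.
    rewrite (_ : [set _ | _] = set0); first exact: msets0.
    by apply/seteqP; split.
  rewrite -[_ `|` _]setCK setCU; apply: msetsC; apply: msetsI;
    by apply/msetsC/msetsI => //; exact: msetsC.
apply/seteqP; split => z /=; rewrite indicE.
  have [zU|zU] := pselect (U z); first by rewrite mem_set//; left.
  by rewrite memNset//; right.
by move=> [[zU]|[zU]]; [rewrite mem_set|rewrite memNset].
Qed.

Definition Giry_unit Z : mhom Z (Giry Z) := MHom (@measurable_gdirac Z).

Section pushforward.
Variables (Z Z' : mspace) (f : mhom Z Z') (mu : gprob R Z).

Definition gpush_fun (U : set Z') : \bar R :=
  if `[< msets U >] then mu (f @^-1` U) else 0%E.

Let gE U : msets U -> gpush_fun U = mu (f @^-1` U).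
Proof. by rewrite /gpush_fun => mU; case: asboolP. Qed.

Let g_out U : ~ msets U -> gpush_fun U = 0%E.
Proof. by rewrite /gpush_fun; case: asboolP. Qed.

Let g0 : gpush_fun set0 = 0%E.
Proof. by rewrite gE ?preimage_set0 ?gmeas0//; exact: msets0. Qed.

Let g_ge0 U : (0 <= gpush_fun U)%E.
Proof. by rewrite /gpush_fun; case: ifPn => // _; exact: gmeas_ge0. Qed.

Let g_sadd (F : (set Z')^nat) : (forall i, msets (F i)) -> trivIset setT F ->
  (fun n => \sum_(0 <= i < n) gpush_fun (F i))%E @ \oo -->
    gpush_fun (\bigcup_n F n).
Proof.
move=> mF tF; rewrite gE; last exact: msets_bigcup.
under eq_fun do under eq_bigr do rewrite gE//.
rewrite preimage_bigcup; apply: gmeas_sigma_additive.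
  by move=> i; exact: mfunctionP.
by apply/trivIsetP => i j _ _ ij; rewrite -preimage_setI;
  move/trivIsetP : tF => ->//; rewrite preimage_set0.
Qed.

Let gT : gpush_fun setT = 1%E.
Proof. by rewrite gE ?preimage_setT ?gmeasT//; exact: msetsT. Qed.

Definition gpush : gprob R Z' := GProb g_out g0 g_ge0 g_sadd gT.

Lemma gpushE U : msets U -> gpush U = mu (f @^-1` U). Proof. exact: gE. Qed.

Lemma gint_gpush (h : Z' -> \bar R) (H' : inhabited Z') :
  measurable_fun [set: mtype H'] (h : mtype H' -> \bar R) ->
  (forall x, 0 <= h x)%E -> gint gpush h = gint mu (h \o f).
Proof.
move=> mh h0; have H := gprob_inhabited mu.
rewrite (gintE H') (gintE H).
pose ff : mtype H -> mtype H' := f.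
have mf : measurable_fun setT ff.
  by move=> _ U mU; rewrite setTI; exact: mfunctionP.
rewrite -[LHS](_ : \int[pushforward (gpr H mu) ff]_x h x = _)%E.
  by rewrite ge0_integral_pushforward// preimage_setT.
by apply: eq_measure_integral => // A mA _; exact/esym/gpushE.
Qed.

End pushforward.

Lemma measurable_gpush Z Z' (f : mhom Z Z') :
  @measurable_map (Giry Z) (Giry Z') (gpush f).
Proof.
apply: measurable_to_Giry => U mU V mV.
have := measurable_gev (mfunctionP f mU) mV.
by congr msets; apply/funext => m; rewrite /mkset gpushE.
Qed.

Section bind.
Variables (Z Z' : mspace) (mu : gprob R Z) (k : mhom Z (Giry Z')).

Definition gbind_fun (U : set Z') : \bar R :=
  if `[< msets U >] then gint mu (fun z => k z U) else 0%E.

Let gE U : msets U -> gbind_fun U = gint mu (fun z => k z U).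
Proof. by rewrite /gbind_fun => mU; case: asboolP. Qed.

Let g_out U : ~ msets U -> gbind_fun U = 0%E.
Proof. by rewrite /gbind_fun; case: asboolP. Qed.

Let g0 : gbind_fun set0 = 0%E.
Proof.
rewrite gE; last exact: msets0.
by apply: integral0_eq => x _; rewrite gmeas0.
Qed.

Let g_ge0 U : (0 <= gbind_fun U)%E.
Proof.
rewrite /gbind_fun; case: ifPn => // _.
by apply: integral_ge0 => x _; exact: gmeas_ge0.
Qed.

Let g_sadd (F : (set Z')^nat) : (forall i, msets (F i)) -> trivIset setT F ->
  (fun n => \sum_(0 <= i < n) gbind_fun (F i))%E @ \oo -->
    gbind_fun (\bigcup_n F n).
Proof.
move=> mF tF; rewrite gE; last exact: msets_bigcup.
under eq_fun do under eq_bigr do rewrite gE//.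
have H := gprob_inhabited mu.
have -> : gint mu (fun z => k z (\bigcup_n F n)) =
    (\sum_(i <oo) gint mu (fun z => k z (F i)))%E.
  rewrite (gintE H); under [RHS]eq_eseriesr do rewrite (gintE H).
  rewrite -integral_nneseries//.
  - apply: eq_integral => z _; apply/esym/cvg_lim => //.
    exact: gmeas_sigma_additive.
  - by move=> n; apply: measurable_gev_comp.
  - by move=> n z _; exact: gmeas_ge0.
apply: is_cvg_nneseries => n _ _.
by apply: integral_ge0 => z _; exact: gmeas_ge0.
Qed.

Let gT : gbind_fun setT = 1%E.
Proof.
rewrite gE; last exact: msetsT.
rewrite /gint; under eq_integral do rewrite gmeasT.
by rewrite integral_cst// mul1e; exact: gmeasT.
Qed.

Definition gbind : gprob R Z' := GProb g_out g0 g_ge0 g_sadd gT.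

Lemma gbindE U : msets U -> gbind U = gint mu (fun z => k z U).
Proof. exact: gE. Qed.

End bind.

End Giry.

Arguments gpr {R Z} H mu U.

Section Giry_kleisli.
Variable R : realType.
Implicit Types Z : mspace.

Lemma measurable_gint Z (f : Z -> \bar R) :
  (forall H : inhabited Z,
     measurable_fun [set: mtype H] (f : mtype H -> \bar R)) ->
  (forall z, 0 <= f z)%E ->
  forall V : set (\bar R), measurable V ->
  @msets (Giry R Z) [set mu : gprob R Z | V (gint mu f)].
Proof.
move=> mf f0 V mV.
have [HG|HG] := pselect (inhabited (gprob R Z)); last first.
  rewrite (_ : [set _ | _] = set0); first exact: msets0.
  by apply/seteqP; split => // x _; case: HG.
have H : inhabited Z by case: HG => /gprob_inhabited.
pose toP : @mtype (Giry R Z) HG -> giry (mtype H) R := fun mu => gpr H mu.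
have mtoP : measurable_fun setT toP.
  apply: measurable_giry_codensity => // U mU _ W mW; rewrite setTI.
  exact: (measurable_gev mU mW).
have := measurableT_comp (measurable_giry_int (mf H) f0) mtoP.
move=> /(_ measurableT V mV); rewrite setTI; congr msets.
by apply/funext => mu; rewrite /mkset (gintE H).
Qed.

Lemma measurable_gbind Z Z' (k : mhom Z (Giry R Z')) :
  @measurable_map (Giry R Z) (Giry R Z') (fun mu => gbind mu k).
Proof.
apply: measurable_to_Giry => U mU V mV.
have := @measurable_gint Z (fun z => k z U) (measurable_gev_comp k mU)
  (fun z => gmeas_ge0 (k z) U) V mV.
by congr msets; apply/funext => mu; rewrite /mkset gbindE.
Qed.

Definition Giry_bind Z Z' (k : mhom Z (Giry R Z')) :
  mhom (Giry R Z) (Giry R Z') := MHom (measurable_gbind k).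

Definition Giry_kcomp Z1 Z2 Z3 (k' : mhom Z2 (Giry R Z3))
    (k : mhom Z1 (Giry R Z2)) : mhom Z1 (Giry R Z3) :=
  mcomp (Giry_bind k') k.

End Giry_kleisli.

(* [qrelts X] is the set M_X of random elements of X. *)
Record qbs (R : realType) := Qbs {
  qcarrier :> Type;
  qrelts : set (R -> qcarrier);
  qrelts_comp : forall (a : R -> qcarrier) (f : R -> R),
    qrelts a -> measurable_fun setT f -> qrelts (a \o f);
  qrelts_cst : forall x : qcarrier, qrelts (cst x);
  qrelts_glue : forall (S : (set R)^nat) (a : nat -> R -> qcarrier)
      (b : R -> qcarrier),
    (forall i, measurable (S i)) -> trivIset setT S -> \bigcup_i S i = setT ->
    (forall i, qrelts (a i)) -> (forall i r, S i r -> b r = a i r) ->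
    qrelts b }.

Record relt (R : realType) (X : qbs R) := Relt {
  rfun :> R -> X;
  rfunP : qrelts rfun }.

Record qhom (R : realType) (X Y : qbs R) := QHom {
  qfun :> X -> Y;
  qfunP : forall a : R -> X, qrelts a -> qrelts (qfun \o a) }.

Section qbs_theory.
Variable R : realType.
Implicit Types X Y Z : qbs R.

Lemma qhomP X Y (f g : qhom X Y) : f =1 g -> f = g.
Proof.
case: f g => [f fP] [g gP] /= /funext fg.
by move: gP; rewrite -fg => gP; congr QHom; exact: Prop_irrelevance.
Qed.

Definition qid X : qhom X X := @QHom R X X id (fun a Ma => Ma).

Definition qcomp X Y Z (g : qhom Y Z) (f : qhom X Y) : qhom X Z :=
  @QHom R X Z (g \o f) (fun a Ma => qfunP g (qfunP f Ma)).

Definition relt_map X Y (f : qhom X Y) (a : relt X) : relt Y :=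
  Relt (qfunP f (rfunP a)).

Definition relt_cst X (x : X) : relt X := Relt (qrelts_cst x).

Section qprod.
Variables X Y : qbs R.

Definition qprod_relts : set (R -> X * Y) :=
  [set f : R -> X * Y | qrelts (fst \o f) /\ qrelts (snd \o f)].

Let qprod_comp (a : R -> X * Y) (f : R -> R) :
  qprod_relts a -> measurable_fun setT f -> qprod_relts (a \o f).
Proof.
move=> [a1 a2] mf; split.
  by rewrite compA; exact: qrelts_comp.
by rewrite compA; exact: qrelts_comp.
Qed.

Let qprod_cst (z : X * Y) : qprod_relts (cst z).
Proof. by split; exact: qrelts_cst. Qed.

Let qprod_glue (S : (set R)^nat) (a : nat -> R -> X * Y) (b : R -> X * Y) :
  (forall i, measurable (S i)) -> trivIset setT S -> \bigcup_i S i = setT ->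
  (forall i, qprod_relts (a i)) -> (forall i r, S i r -> b r = a i r) ->
  qprod_relts b.
Proof.
move=> mS tS ST Ma ba; split.
  apply: (qrelts_glue mS tS ST (fun i => (Ma i).1)) => i r Sir /=.
  by rewrite (ba i).
apply: (qrelts_glue mS tS ST (fun i => (Ma i).2)) => i r Sir /=.
by rewrite (ba i).
Qed.

Definition qprod : qbs R := Qbs qprod_comp qprod_cst qprod_glue.

End qprod.

Lemma qcurry_subproof X Y Z (f : qhom (qprod X Y) Z) (x : X) (a : R -> Y) :
  qrelts a -> qrelts ((fun y => f (x, y)) \o a).
Proof.
move=> Ma; apply: (@qfunP _ _ _ f (fun r => (x, a r))).
by split => //; exact: qrelts_cst.
Qed.

Lemma qcurry_swap_subproof X Y Z (f : qhom (qprod X Y) Z) (y : Y)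
  (a : R -> X) : qrelts a -> qrelts ((fun x => f (x, y)) \o a).
Proof.
move=> Ma; apply: (@qfunP _ _ _ f (fun r => (a r, y))).
by split => //; exact: qrelts_cst.
Qed.

Definition qcurry X Y Z (f : qhom (qprod X Y) Z) (x : X) : qhom Y Z :=
  QHom (@qcurry_subproof X Y Z f x).

Definition qcurry_swap X Y Z (f : qhom (qprod X Y) Z) (y : Y) : qhom X Z :=
  QHom (@qcurry_swap_subproof X Y Z f y).

Section L.
Variable X : qbs R.

Definition qsets : set (set X) :=
  [set U | forall a : R -> X, qrelts a -> measurable (a @^-1` U)].

Lemma qsets_sigma_algebra : sigma_algebra setT qsets.
Proof.
split => [a _|A mA a Ma|F mF a Ma].
- by rewrite preimage_set0; exact: measurable0.
- by rewrite setTD preimage_setC; apply: measurableC; exact: mA.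
- by rewrite preimage_bigcup; apply: bigcupT_measurable => i; exact: mF.
Qed.

Definition L : mspace := MSpace qsets_sigma_algebra.

Definition relt_mhom (a : relt X) : mhom (borel R) L :=
  @MHom (borel R) L a (fun U mU => mU a (rfunP a)).

End L.

Lemma L_map_subproof X Y (f : qhom X Y) : @measurable_map (L X) (L Y) f.
Proof. by move=> U mU a Ma; exact: (mU _ (qfunP f Ma)). Qed.

Definition L_map X Y (f : qhom X Y) : mhom (L X) (L Y) :=
  MHom (@L_map_subproof X Y f).

End qbs_theory.

Section standard_borel.
Variable R : realType.
Implicit Types Z : mspace.

Definition standard_borel Z : Prop :=
  (exists f : Z -> borel R, measurable_iso f) \/
  (countable [set: Z] /\ forall U : set Z, msets U).

Section qbs_of_mspace.
Variable Z : mspace.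

Definition mspace_relts : set (R -> Z) :=
  [set a | @measurable_map (borel R) Z a].

Let mr_comp (a : R -> Z) (f : R -> R) :
  mspace_relts a -> measurable_fun setT f -> mspace_relts (a \o f).
Proof. by move=> Ma mf U /Ma /(mf measurableT); rewrite setTI. Qed.

Let mr_cst (z : Z) : mspace_relts (cst z).
Proof. by move=> U mU; rewrite preimage_cst; case: ifP => _; [exact: msetsT|exact: msets0]. Qed.

Let mr_glue (S : (set R)^nat) (a : nat -> R -> Z) (b : R -> Z) :
  (forall i, measurable (S i)) -> trivIset setT S -> \bigcup_i S i = setT ->
  (forall i, mspace_relts (a i)) -> (forall i r, S i r -> b r = a i r) ->
  mspace_relts b.
Proof.
move=> mS tS ST Ma ba U mU.
rewrite (_ : b @^-1` U = \bigcup_i (S i `&` a i @^-1` U)).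
  by apply: bigcupT_measurable => i; apply: measurableI => //; exact: Ma.
apply/seteqP; split => [r bU|r [i _ [Sir]]]; last by rewrite /= (ba i).
have [i _ Sir] : (\bigcup_i S i) r by rewrite ST.
by exists i => //; split => //=; rewrite -(ba i).
Qed.

Definition qbs_of : qbs R := Qbs mr_comp mr_cst mr_glue.

End qbs_of_mspace.

Lemma standard_borel_L Z : standard_borel Z ->
  @msets (L (qbs_of Z)) = @msets Z.
Proof.
move=> sZ; apply/seteqP; split => [U|U mU a Ma]; last exact: Ma.
case: sZ => [[f [mf [g [mg fK _]]]]|[_ //]].
move=> /(_ _ mg) /mf; congr msets; apply/funext => z.
by rewrite /preimage /mkset fK.
Qed.

End standard_borel.

(* Countably many copies of the line embed into it measurably: [code i] maps R
   into [cell i], the cells partition R, and [decode i] is a left inverse.  This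
   is what makes the random elements of P(X) closed under countable gluing. *)
Section coding.
Variable R : realType.

Definition code (i : nat) (x : R) : R := i%:R *+ 2 + x * (1 + `|x|) `^ (-1).

Definition decode (i : nat) (r : R) : R :=
  (r - i%:R *+ 2) * (1 - `|r - i%:R *+ 2|) `^ (-1).

Definition cell (i : nat) : set R := [set r | Num.truncn ((r + 1) / 2) = i].

Lemma measurable_code i : measurable_fun setT (code i).
Proof.
apply: measurable_funD => //; apply: measurable_funM => //.
apply: (measurableT_comp (measurable_powR _)).
by apply: measurable_funD => //; exact: measurableT_comp.
Qed.

Lemma measurable_decode i : measurable_fun setT (decode i).
Proof.
have mB : measurable_fun setT (fun r : R => r - i%:R *+ 2).
  exact: measurable_funB.
apply: measurable_funM => //.
apply: (measurableT_comp (measurable_powR _)).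
by apply: measurable_funB => //; exact: measurableT_comp.
Qed.

Lemma codeK i : cancel (code i) (decode i).
Proof.
move=> x; rewrite /decode /code addrC addKr.
have x0 : 0 < 1 + `|x| by have := normr_ge0 x; lra.
rewrite powR_inv1 ?ltW// normrM normfV (gtr0_norm x0).
rewrite (_ : 1 - _ = (1 + `|x|)^-1); last by field; rewrite gt_eqF.
by rewrite powR_inv1 ?invr_ge0 ?ltW// invrK divfK// gt_eqF.
Qed.

Lemma cell_code i x : cell i (code i x).
Proof.
have x0 : 0 < 1 + `|x| by have := normr_ge0 x; lra.
have : `|x / (1 + `|x|)| < 1.
  by rewrite normrM normfV (gtr0_norm x0) ltr_pdivrMr//; lra.
rewrite /cell /mkset /code powR_inv1 ?ltW// ltr_norml.
set y := x / _ => /andP[y1 y2]; apply: truncn_def.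
rewrite (_ : (_ + _) / 2 = i%:R + (y + 1) / 2); last by field.
by rewrite -[i.+1%:R]natr1; apply/andP; split; lra.
Qed.

Lemma measurable_cell i : measurable (cell i).
Proof.
pose D n := [set r : R | (Num.truncn ((r + 1) / 2) <= n)%N].
have mD n : measurable (D n).
  rewrite (_ : D n = `]-oo, n.+1%:R *+ 2 - 1[%classic)//.
  apply/funext => r; apply/propext; rewrite /D /= in_itv /=.
  rewrite real_truncn_le_nat ?num_real// ltr_pdivrMr//.
  by split; lra.
case: i => [|i].
  rewrite (_ : cell 0 = D 0%N)//; apply/funext => r; apply/propext.
  by rewrite /cell /D /= leqn0; split => [->//|/eqP].
rewrite (_ : cell i.+1 = D i.+1 `\` D i); first exact: measurableD.
apply/funext => r; apply/propext; rewrite /cell /D /=.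
split=> [->|[h1 /negP]]; first by split => //; rewrite ltnn.
by rewrite -ltnNge => h2; apply/eqP; rewrite eqn_leq h1.
Qed.

Lemma trivIset_cell : trivIset setT cell.
Proof.
apply/trivIsetP => i j _ _ /eqP ij; apply/seteqP; split => // r [h1 h2].
by case: ij; rewrite -h1 -h2.
Qed.

Lemma bigcup_cell : \bigcup_i cell i = setT.
Proof. by apply/seteqP; split => // r _; exists (Num.truncn ((r + 1) / 2)). Qed.

Lemma coding_fun_mhom (f : R -> R) : measurable_fun setT f ->
  @measurable_map (borel R) (borel R) f.
Proof. by move=> mf U mU; have := mf measurableT U mU; rewrite setTI. Qed.

Definition code_mhom i : mhom (borel R) (borel R) :=
  MHom (coding_fun_mhom (measurable_code i)).

End coding.

Section P.
Variable R : realType.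

Record qprob (X : qbs R) := QProb {
  qrv : relt X;
  qlaw : gprob R (borel R) }.

HB.instance Definition _ X := gen_eqMixin (qprob X).
HB.instance Definition _ X := gen_choiceMixin (qprob X).

Section P_carrier.
Variable X : qbs R.

Definition qprob_push (p : qprob X) : gprob R (L X) :=
  gpush (relt_mhom (qrv p)) (qlaw p).

Definition qprob_eqv : rel (qprob X) :=
  fun p q => `[< qprob_push p = qprob_push q >].

Let qprob_eqv_refl : reflexive qprob_eqv.
Proof. by move=> p; exact/asboolP. Qed.

Let qprob_eqv_sym : symmetric qprob_eqv.
Proof. by move=> p q; apply/asboolP/asboolP => ->. Qed.

Let qprob_eqv_trans : transitive qprob_eqv.
Proof. by move=> q p r /asboolP pq /asboolP qr; apply/asboolP; rewrite pq. Qed.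

Canonical qprob_equiv : equiv_rel (qprob X) :=
  EquivRel qprob_eqv qprob_eqv_refl qprob_eqv_sym qprob_eqv_trans.

Definition P_carrier : Type := {eq_quot qprob_equiv}.

Definition qclass (a : relt X) (mu : gprob R (borel R)) : P_carrier :=
  \pi_({eq_quot qprob_equiv}) (QProb a mu).

Definition P_repr (t : P_carrier) : qprob X := repr (t : {eq_quot qprob_equiv}).

Lemma P_reprK t : qclass (qrv (P_repr t)) (qlaw (P_repr t)) = t.
Proof. by rewrite /qclass -[RHS]reprK /P_repr; case: (repr _). Qed.

Lemma qclassP a mu b nu : qclass a mu = qclass b nu <->
  gpush (relt_mhom a) mu = gpush (relt_mhom b) nu.
Proof.
split=> [/eqquotP/asboolP//|e].
by apply/eqquotP/asboolP.
Qed.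

Definition l_fun (t : P_carrier) : gprob R (L X) := qprob_push (P_repr t).

Lemma l_funE a mu : l_fun (qclass a mu) = gpush (relt_mhom a) mu.
Proof. by rewrite /l_fun /qprob_push; apply/qclassP; rewrite P_reprK. Qed.

Lemma l_fun_inj : injective l_fun.
Proof.
by move=> s t; rewrite -(P_reprK s) -(P_reprK t) !l_funE => /qclassP.
Qed.

Definition P_relts : set (R -> P_carrier) :=
  [set b | exists ag : relt X * mhom (borel R) (Giry R (borel R)),
    forall r : R, b r = qclass ag.1 (ag.2 r)].

Let P_comp (b : R -> P_carrier) (f : R -> R) :
  P_relts b -> measurable_fun setT f -> P_relts (b \o f).
Proof.
move=> [[a g] bE] /coding_fun_mhom mf.
by exists (a, mcomp g (MHom mf)) => r /=; rewrite bE.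
Qed.

Let P_cst (t : P_carrier) : P_relts (cst t).
Proof.
have mc : @measurable_map (borel R) (Giry R (borel R)) (cst (qlaw (P_repr t))).
  move=> U _; rewrite preimage_cst; case: ifP => _.
    exact: measurableT.
  exact: measurable0.
by exists (qrv (P_repr t), MHom mc) => r; rewrite /= P_reprK.
Qed.

Let P_glue (S : (set R)^nat) (b : nat -> R -> P_carrier) (c : R -> P_carrier) :
  (forall i, measurable (S i)) -> trivIset setT S -> \bigcup_i S i = setT ->
  (forall i, P_relts (b i)) -> (forall i r, S i r -> c r = b i r) ->
  P_relts c.
Proof.
move=> mS tS ST Mb cb.
have [ag agE] := choice Mb.
pose a r := let i := Num.truncn ((r + 1) / 2) in (ag i).1 (decode i r).
have Ma : qrelts a.
  apply: (@qrelts_glue _ X (@cell R) (fun i => (ag i).1 \o decode i)).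
  - exact: measurable_cell.
  - exact: trivIset_cell.
  - exact: bigcup_cell.
  - by move=> i; apply: qrelts_comp; [exact: rfunP|exact: measurable_decode].
  - by move=> i r ri; rewrite /a ri.
have exS r : exists i, S i r.
  by have [i _ Sir] : (\bigcup_i S i) r by [rewrite ST]; exists i.
have [n nS] := choice exS.
have nE i r : S i r -> n r = i.
  move=> Sir; apply: contrapT => /eqP ne; move/trivIsetP : tS => /(_ (n r) i I I ne).
  by move/seteqP => [/(_ r (conj (nS r) Sir))].
pose g r : gprob R (borel R) := gpush (code_mhom R (n r)) ((ag (n r)).2 r).
have mg : @measurable_map (borel R) (Giry R (borel R)) g.
  move=> U mU; rewrite (_ : g @^-1` U = \bigcup_i (S i `&`
      (fun r => gpush (code_mhom R i) ((ag i).2 r)) @^-1` U)).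
    apply: bigcupT_measurable => i; apply: measurableI => //.
    exact: (mfunctionP (ag i).2 (measurable_gpush (code_mhom R i) mU)).
  apply/seteqP; split => [r gU|r [i _ [/nE <-]]//].
  by exists (n r).
exists (Relt Ma, MHom mg) => r /=.
rewrite (cb _ _ (nS r)) agE; apply/qclassP; apply: gprobP => U mU.
rewrite /g !gpushE//; last exact: (mfunctionP (relt_mhom (Relt Ma)) mU).
congr (gmeas _ _); apply/funext => x.
by rewrite /preimage /mkset /= /a cell_code codeK.
Qed.

Definition P : qbs R := Qbs P_comp P_cst P_glue.

Lemma measurable_l : @measurable_map (L P) (Giry R (L X)) l_fun.
Proof.
move=> A mA b [[a g] bE].
have := mfunctionP g (measurable_gpush (relt_mhom a) mA).
by congr msets; apply/funext => r; rewrite /preimage /mkset bE l_funE.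
Qed.

Definition l : mhom (L P) (Giry R (L X)) := MHom measurable_l.

(* The choice of the law is irrelevant: see [P_unitE]. *)
Definition P_unit_fun (x : X) : P := qclass (relt_cst x) (gdirac R (0 : borel R)).

Lemma P_unitE x mu : P_unit_fun x = qclass (relt_cst x) mu.
Proof.
apply/qclassP/gprobP => U mU; rewrite !gpushE//.
rewrite (_ : _ @^-1` U = if x \in U then setT else set0).
  by case: ifP => _; rewrite ?gmeasT ?gmeas0.
exact: preimage_cst.
Qed.

Lemma P_unit_subproof (a : R -> X) : qrelts a -> qrelts (P_unit_fun \o a).
Proof.
move=> Ma; exists (Relt Ma, Giry_unit R (borel R)) => r /=.
apply/qclassP/gprobP => U mU; rewrite !gpushE//.
rewrite !gdiracE//; [exact: (mfunctionP (relt_mhom (Relt Ma)))|].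
exact: (mfunctionP (relt_mhom (relt_cst (a r)))).
Qed.

Definition P_unit : qhom X P := QHom P_unit_subproof.

End P_carrier.

End P.

Section P_bind.
Variable R : realType.
Implicit Types X Y Z : qbs R.

(* The representative (a, mu) of t and the pair (b, g) with f (a r) = [b, g r]
   are picked by choice; [P_bindE] shows that the picks do not matter. *)
Definition P_bind X Y (t : P X) (f : qhom X (P Y)) : P Y :=
  let p := P_repr t in
  let bg := projT1 (cid (qfunP f (rfunP (qrv p)))) in
  qclass bg.1 (gbind (qlaw p) bg.2).

(* The image of a Kleisli morphism X -> P(Y) in the Kleisli category of G. *)
Definition Kleisli_L X Y (f : qhom X (P Y)) : mhom (L X) (Giry R (L Y)) :=
  mcomp (l Y) (L_map f).

Lemma l_gbind X Y (f : qhom X (P Y)) (a : relt X) mu (b : relt Y)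
    (g : mhom (borel R) (Giry R (borel R))) :
  (forall r, f (a r) = qclass b (g r)) ->
  l Y (qclass b (gbind mu g)) = gbind (l X (qclass a mu)) (Kleisli_L f).
Proof.
move=> fE; rewrite /l /= !l_funE; apply: gprobP => U mU.
have mbU := mfunctionP (relt_mhom b) mU.
rewrite gpushE// !gbindE//.
have HX : inhabited (L X) by exact: inhabits (a 0).
rewrite (gint_gpush _ _ (@measurable_gev_comp R _ _ (Kleisli_L f) U mU HX))//; last first.
  by move=> x; exact: gmeas_ge0.
congr gint; apply/funext => r.
transitivity (l_fun (f (a r)) U); last by [].
by rewrite fE l_funE gpushE.
Qed.

Lemma P_bindE X Y (f : qhom X (P Y)) (a : relt X) mu (b : relt Y)
    (g : mhom (borel R) (Giry R (borel R))) :
  (forall r, f (a r) = qclass b (g r)) ->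
  P_bind (qclass a mu) f = qclass b (gbind mu g).
Proof.
move=> fE; apply: l_fun_inj; apply: etrans (esym (l_gbind mu fE)).
rewrite /P_bind; case: cid => -[b' g'] /= fE'.
by apply: etrans (l_gbind _ fE') _; rewrite P_reprK.
Qed.

Lemma P_bind_subproof X Y (f : qhom X (P Y)) (s : R -> P X) :
  qrelts s -> qrelts ((fun t => P_bind t f) \o s).
Proof.
move=> [[a g] sE]; have [[b h] fE] := qfunP f (rfunP a).
by exists (b, mcomp (Giry_bind h) g) => r /=; rewrite sE (P_bindE _ fE).
Qed.

Definition P_bind_hom X Y (f : qhom X (P Y)) : qhom (P X) (P Y) :=
  QHom (@P_bind_subproof X Y f).

Definition P_map X Y (f : qhom X Y) : qhom (P X) (P Y) :=
  P_bind_hom (qcomp (P_unit Y) f).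

Definition P_kcomp X Y Z (g : qhom Y (P Z)) (f : qhom X (P Y)) :
  qhom X (P Z) := qcomp (P_bind_hom g) f.

End P_bind.

(* Main.v *)
From HB Require Import structures.
Require Import Defs.
From mathcomp Require Import all_boot all_order all_algebra.
From mathcomp Require Import lra.
From mathcomp Require Import all_classical all_reals all_analysis.
From mathcomp Require Import measurable_realfun.

(* Both nontrivial parts rest on coding a countable family of bits as one real
   (its ternary digits), so that a measurable family of such data becomes a
   measurable real-valued function with a measurable left inverse.

   Commutativity: the plane is in this way a measurable retract of the line, so
   (r, s) |-> f (a r, b s) has the form [c, g (pair_code (r, s))] with a single
   random element c and a single kernel g on the line; both iterated binds are
   then [c, -] of iterated integrals of g, and Fubini-Tonelli applies.

   Standard Borel spaces: the space of laws on the line is also a measurable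
   retract of the line.  A law is coded by its distribution function at the
   rationals, and a real r is decoded as the pushforward of the uniform law on
   [0, 1] along the quantile function read off r, which is a law whatever r is
   and depends measurably on r. *)

Set Implicit Arguments.
Unset Strict Implicit.
Unset Printing Implicit Defensive.

Import Order.TTheory GRing.Theory Num.Theory.
Import numFieldNormedType.Exports.

Local Open Scope classical_set_scope.
Local Open Scope ring_scope.

(** * Coding bits as reals *)

Section ternary.
Variable R : realType.
Implicit Types (b : nat -> bool) (r : R).

(** The sum of [b k / 3^(k+1)] over [k < n], in Horner form so that dropping the first digit is a
    recursion on the sequence. *)
Fixpoint ternary_psum n b : R :=
  if n is n'.+1 then ((b 0%N)%:R + ternary_psum n' (b \o succn)) / 3 else 0.

Definition ternary b : R := limn (ternary_psum ^~ b).

(** Removes the leading digit. As only the digits 0 and 1 occur, a leading 0 gives a value at most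
    1/6 and a leading 1 a value at least 1/3, so a test against 1/3 avoids the ambiguity of binary
    expansions. *)
Definition ternary_shift r : R := if 3^-1 <= r then 3 * r - 1 else 3 * r.

Definition ternary_digit n r : bool := 3^-1 <= iter n ternary_shift r.

Lemma ternary_psum_bound n b : 0 <= ternary_psum n b <= 2^-1.
Proof.
elim: n b => [|n IH] b /=; first lra.
by have := IH (b \o succn); case: (b 0%N) => /=; lra.
Qed.

Lemma nondecreasing_ternary_psum b :
  nondecreasing_seq (ternary_psum ^~ b).
Proof.
apply/nondecreasing_seqP => n; elim: n b => [|n IH] b.
  by have /andP[] := ternary_psum_bound 1 b.
have {IH} := IH (b \o succn).
by move=> /= ; lra.
Qed.

Lemma is_cvg_ternary_psum b : cvgn (ternary_psum ^~ b).
Proof.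
apply: nondecreasing_is_cvgn; first exact: nondecreasing_ternary_psum.
by exists 2^-1 => _ [n _ <-]; have /andP[] := ternary_psum_bound n b.
Qed.

Lemma ternary_bound b : 0 <= ternary b <= 2^-1.
Proof.
apply/andP; split; [apply: limr_ge|apply: limr_le];
  try exact: is_cvg_ternary_psum;
  by near=> n; have /andP[] := ternary_psum_bound n b.
Unshelve. all: by end_near. Qed.

Lemma ternary_rec b :
  ternary b = ((b 0%N)%:R + ternary (b \o succn)) / 3.
Proof.
apply: cvg_lim => //; rewrite -cvg_shiftS.
apply: cvgMl; apply: cvgD; first exact: cvg_cst.
exact: is_cvg_ternary_psum.
Qed.

Lemma ternary_shiftE b : ternary_shift (ternary b) = ternary (b \o succn).
Proof.
have := ternary_bound (b \o succn); rewrite /ternary_shift (ternary_rec b).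
by move=> bd; case: (b 0%N); case: leP => /=; lra.
Qed.

Lemma ternaryK n b : ternary_digit n (ternary b) = b n.
Proof.
rewrite /ternary_digit; elim: n b => [|n IH] b; last first.
  by rewrite iterSr ternary_shiftE IH.
have := ternary_bound (b \o succn); rewrite /= (ternary_rec b).
case: (b 0%N) => /= h; first by apply/idP; lra.
by apply/negP => h'; lra.
Qed.

Lemma measurable_ternary d (T : measurableType d) (b : T -> nat -> bool) :
  (forall n, measurable [set z | b z n]) ->
  measurable_fun setT (fun z => ternary (b z)).
Proof.
move=> mb.
apply: (@measurable_fun_cvg _ _ _ _
  (fun n z => ternary_psum n (b z))) => [n|z _]; last first.
  exact: is_cvg_ternary_psum.
elim: n b mb => [|n IH] b mb /=; first exact: measurable_cst.
apply: measurable_funM => //; apply: measurable_funD; last first.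
  by apply: (IH (fun z => b z \o succn)) => k; exact: mb.
have -> : (fun z => (b z 0%N)%:R) = \1_[set z | b z 0%N] :> (T -> R).
  apply/funext => z; rewrite indicE; congr (_%:R); congr nat_of_bool.
  by apply/idP/idP; rewrite inE.
exact: measurable_indic.
Qed.

Lemma measurable_ternary_digit n : measurable [set r | ternary_digit n r].
Proof.
have ms : measurable_fun setT (iter n ternary_shift).
  elim: n => [|n IH]; first exact: measurable_id.
  apply: measurableT_comp IH; apply: measurable_fun_ifT => //=.
  - exact: measurable_fun_ler.
  - by apply: measurable_funB => //; exact: measurable_funM.
rewrite -[X in measurable X]setTI.
rewrite (_ : [set r | _] = iter n ternary_shift @^-1` `[3^-1, +oo[%classic).
  exact: ms.
by apply/seteqP; split => r; rewrite /= in_itv/= andbT.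
Qed.

End ternary.

Section coding.
Variables (R : realType) (I : countType).

Definition bits_code (b : I -> bool) : R :=
  ternary R (fun n => if unpickle n is Some i then b i else false).

Definition bits_decode (r : R) (i : I) : bool := ternary_digit (pickle i) r.

Lemma bits_codeK b i : bits_decode (bits_code b) i = b i.
Proof. by rewrite /bits_decode ternaryK pickleK. Qed.

Lemma measurable_bits_code d (T : measurableType d) (b : T -> I -> bool) :
  (forall i, measurable [set z | b z i]) ->
  measurable_fun setT (fun z => bits_code (b z)).
Proof.
move=> mb; apply: measurable_ternary => n.
case: unpickle => [i|]; first exact: mb.
by rewrite (_ : [set _ | _] = set0)//; apply/seteqP; split.
Qed.

Lemma measurable_bits_decode i : measurable [set r | bits_decode r i].
Proof. exact: measurable_ternary_digit. Qed.

End coding.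

(** * Reals as infima of sets of rationals *)

Section rat_inf.
Variable R : realType.
Implicit Types (B : set rat) (t m : R).

(** [fine] sends the infinite infimum of an empty set, or of one unbounded below, to 0. *)
Definition rat_inf B : R := fine (ereal_inf [set (ratr q)%:E | q in B]).

Lemma rat_inf_lt B t m : B !=set0 -> (forall q, B q -> m <= ratr q) ->
  rat_inf B < t <-> exists2 q, B q & ratr q < t.
Proof.
move=> [q0 Bq0] Bm; rewrite -lte_fin fineK; last first.
  rewrite fin_real//; apply/andP; split.
    apply: (@lt_le_trans _ _ m%:E); first exact: ltNyr.
    by apply/ereal_infP => _ [q Bq <-]; rewrite lee_fin Bm.
  apply: (@le_lt_trans _ _ (ratr q0)%:E); last exact: ltry.
  by apply: ereal_inf_lbound; exists q0.
split=> [/ereal_inf_ltP[_ [q Bq <-]]|[q Bq qt]]; first by exists q.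
by apply/ereal_inf_ltP; exists (ratr q)%:E => //; exists q.
Qed.

Lemma rat_inf_gt t : rat_inf [set q | t < ratr q] = t.
Proof.
have lt s : rat_inf [set q | t < ratr q] < s <-> t < s.
  rewrite (@rat_inf_lt _ _ t); first split.
  - by move=> [q /= tq /(lt_trans tq)].
  - by move=> /rat_in_itvoo[q]; rewrite in_itv/= => /andP[]; exists q.
  - have /rat_in_itvoo[q] : t < t + 1 by lra.
    by rewrite in_itv/= => /andP[]; exists q.
  - by move=> q /ltW.
apply/eqP; rewrite eq_le; apply/andP; split; rewrite leNgt; apply/negP => h.
  by have := (lt _).2 h; rewrite ltxx.
by have := (lt _).1 h; rewrite ltxx.
Qed.

(** An infimum is below [r] exactly when some rational [q < r] lies in the set, which is a countable
    union of events. *)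
Lemma measurable_rat_inf d (T : measurableType d) (B : T -> set rat) :
  (forall q, measurable [set z | B z q]) ->
  measurable_fun setT (fun z => rat_inf (B z)).
Proof.
move=> mB; apply: measurableT_comp => //.
apply: (measurability (@ErealGenInftyO.G R)).
  exact: ErealGenInftyO.measurableE.
move=> _ [_ [r ->] <-]; rewrite setTI.
rewrite (_ : _ @^-1` _ =
    \bigcup_(q in [set q : rat | ratr q < r]) [set z | B z q]).
  rewrite bigcup_mkcond; apply: bigcupT_measurable_rat => q.
  by case: ifP.
apply/seteqP; split => z /=; rewrite in_itv/=.
  by move=> /ereal_inf_ltP[_ [q Bq <-]]; rewrite lte_fin; exists q.
move=> [q /= qr Bq]; apply/ereal_inf_ltP.
by exists (ratr q)%:E => //; exists q.
Qed.

End rat_inf.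

(** * Laws on the line *)

Section line_probability.
Context {R : realType}.
Implicit Types P : probability R R.

(** Left continuity of the distribution function: otherwise monotonicity bounds every ray ending
    before [t] by [u], hence also their increasing union. *)
Lemma probability_ray_rat P (t : R) (u : \bar R) : (u < P `]-oo, t[%classic)%E ->
  exists2 q : rat, ratr q < t & (u < P `]-oo, ratr q[%classic)%E.
Proof.
move=> ut; apply: contrapT => H.
have P_le s : s < t -> (P `]-oo, s[%classic <= u)%E.
  move=> /rat_in_itvoo[q]; rewrite in_itv/= => /andP[sq qt].
  rewrite leNgt; apply/negP => us; apply: H; exists q => //.
  apply: (lt_le_trans us); apply: le_measure; rewrite ?inE//.
  by move=> x /=; rewrite !in_itv/= => /lt_trans; exact.
pose F n := `]-oo, t - n.+1%:R^-1[%classic.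
have FE : \bigcup_n F n = `]-oo, t[%classic.
  apply/seteqP; split => [x [n _]|x]; rewrite /F/= !in_itv/=.
    by move/lt_trans; apply; rewrite ltrBlDr ltrDl.
  (* This [n] satisfies [1 / (t - x) < n + 1], that is, [x < t - 1 / (n + 1)]. *)
  move=> xt; exists (Num.truncn (t - x)^-1) => //=; rewrite in_itv/=.
  rewrite ltrBrDl -ltrBrDr -[ltRHS]invrK ltf_pV2 ?posrE ?invr_gt0 ?subr_gt0//.
  exact: truncnS_gt.
have PF : P \o F @ \oo --> P (\bigcup_n F n).
  apply: nondecreasing_cvg_mu; [by move=> i; exact: measurable_itv| |].
    by rewrite FE; exact: measurable_itv.
  move=> m n mn; apply/subsetPset => x; rewrite /F/= !in_itv/=.
  move=> /lt_le_trans; apply; rewrite lerD2l lerN2 lef_pV2 ?posrE// ler_nat.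
  by rewrite ltnS.
move: ut; apply/negP; rewrite -leNgt -FE; apply: (cvge_to_le PF).
by apply: nearW => n; apply: P_le; rewrite ltrBlDr ltrDl.
Qed.

(** Continuity from below along the rays []-oo, n[], whose union is the line. *)
Lemma probability_ray_gt P (u : \bar R) : (u < 1)%E ->
  exists q : rat, (u < P `]-oo, ratr q[%classic)%E.
Proof.
move=> u1; apply: contrapT => H.
pose F n : set R := `]-oo, n%:R[%classic.
have FE : \bigcup_n F n = setT.
  apply/seteqP; split => // x _; exists (Num.truncn x).+1 => //; rewrite /F/=.
  by rewrite in_itv/= truncnS_gt.
have PF : P \o F @ \oo --> P (\bigcup_n F n).
  apply: nondecreasing_cvg_mu; [by move=> i; exact: measurable_itv| |].
    by rewrite FE.
  move=> m n mn; apply/subsetPset => x; rewrite /F/= !in_itv/=.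
  by move=> /lt_le_trans; apply; rewrite ler_nat.
move: u1; apply/negP; rewrite -leNgt -(probability_setT P) -FE.
apply: (cvge_to_le PF); apply: nearW => n; rewrite leNgt; apply/negP => un; apply: H.
by exists n%:R; rewrite ratr_nat.
Qed.

(** Continuity from above along the rays []-oo, -n[], whose intersection is empty. *)
Lemma probability_ray_le P (u : \bar R) : (0 < u)%E ->
  exists m : R, (P `]-oo, m[%classic <= u)%E.
Proof.
move=> u0; apply: contrapT => H.
pose F n : set R := `]-oo, - n%:R[%classic.
have FE : \bigcap_n F n = set0.
  apply/seteqP; split => // x /(_ (Num.truncn (- x)).+1 I).
  by rewrite /F/= in_itv/= ltrNr => /lt_trans/(_ (truncnS_gt _)); rewrite ltxx.
have PF : P \o F @ \oo --> P (\bigcap_n F n).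
  apply: nonincreasing_cvg_mu.
  - apply: (le_lt_trans (probability_le1 _ _)); last exact: ltry.
    exact: measurable_itv.
  - by move=> i; exact: measurable_itv.
  - by rewrite FE.
  - move=> m n mn; apply/subsetPset => x; rewrite /F/= !in_itv/=.
    by move=> /lt_le_trans; apply; rewrite lerN2 ler_nat.
move: u0; apply/negP; rewrite -leNgt -(measure0 P) -FE.
apply: (cvge_to_ge PF); apply: nearW => n; rewrite leNgt; apply/negP => un; apply: H.
by exists (- n%:R); exact: ltW.
Qed.

Lemma uniform01E (U : set R) : measurable U ->
  uniform_prob (@ltr01 R) U = lebesgue_measure (U `&` `[0, 1]%classic).
Proof.
move=> mU; rewrite /uniform_prob integral_uniform_pdf.
rewrite (eq_integral (cst 1%E)).
  by rewrite integral_cst ?mul1e//; exact: measurableI.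
move=> x; rewrite inE => -[_]; rewrite /uniform_pdf /= in_itv/= => ->.
by rewrite subr0 invr1.
Qed.

(** The complement of []0, 1[] is null. This discards the levels at which a quantile may be infinite
    and [rat_inf] takes its default value. *)
Lemma eq_uniform01 (A B : set R) : measurable A -> measurable B ->
  (forall u : R, 0 < u < 1 -> A u <-> B u) ->
  uniform_prob (@ltr01 R) A = uniform_prob (@ltr01 R) B.
Proof.
move=> mA mB AB; pose D : set R := `]0, 1[%classic.
have P0 : uniform_prob (@ltr01 R) (~` D) = 0%E.
  have PD : uniform_prob (@ltr01 R) D = 1%E.
    rewrite uniform01E; last exact: measurable_itv.
    rewrite setIidl; last exact: subset_itvW.
    by rewrite lebesgue_measure_itv/= lte_fin ltr01 oppr0 adde0.
  have := probability_setC (uniform_prob (@ltr01 R)) (measurable_itv `]0, 1[).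
  by rewrite [X in (_ - X)%E]PD subee.
suff le (A' B' : set R) : measurable A' -> measurable B' ->
    (forall u : R, 0 < u < 1 -> A' u -> B' u) ->
    (uniform_prob (@ltr01 R) A' <= uniform_prob (@ltr01 R) B')%E.
  by apply/eqP; rewrite eq_le !le// => u /AB [].
move=> mA' mB' AB'.
have mD : measurable (~` D) by apply: measurableC; exact: measurable_itv.
rewrite -[leRHS]adde0 -[in leRHS]P0.
have := measureU2 (uniform_prob (@ltr01 R)) mB' mD.
apply: le_trans.
apply: le_measure; rewrite ?inE//; first exact: measurableU.
move=> u A'u; have [Du|] := pselect (D u); last by right.
by left; apply: AB' => //; move: Du; rewrite /D/= in_itv.
Qed.

End line_probability.

Section gprob_on_the_line.
Context {R : realType}.
Implicit Types mu nu : gprob R (borel R).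

(** A copy of [mu] with the library's probability structure over [R] itself, where the results on
    intervals and on iterated integrals apply; [gpr] lives over [mtype H]. [of_line] goes the other
    way. *)
Definition gline mu (U : set R) : \bar R := mu U.

HB.instance Definition _ mu := isMeasure.Build _ R R (gline mu)
  (gmeas0 mu) (gmeas_ge0 mu) 
  (fun F mF tF _ => @gmeas_sigma_additive _ _ mu F mF tF).
HB.instance Definition _ mu :=
  Measure_isProbability.Build _ _ _ (gline mu) (gmeasT mu).

Definition of_line (P : probability (measurableTypeR R) R) (H : inhabited (borel R))
  (U : set (mtype H)) : \bar R := P U.

HB.instance Definition _ (P : probability (measurableTypeR R) R) H :=
  isMeasure.Build _ _ _ (@of_line P H)
    (measure0 P) (measure_ge0 P) (@measure_semi_sigma_additive _ _ _ P).
HB.instance Definition _ (P : probability (measurableTypeR R) R) H :=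
  Measure_isProbability.Build _ _ _ (@of_line P H) (probability_setT P).

Definition gprob_line (P : probability (measurableTypeR R) R) : gprob R (borel R) :=
  gprob_of (@of_line P (inhabits (0 : R)) : probability _ R).

Lemma gprob_lineE (P : probability (measurableTypeR R) R) (U : set R) :
  measurable U -> gprob_line P U = P U.
Proof. by move=> mU; rewrite /gprob_line gprob_ofE. Qed.

Lemma gint_gline mu (f : R -> \bar R) : measurable_fun setT f ->
  (forall x, 0 <= f x)%E -> gint mu f = (\int[gline mu]_x f x)%E.
Proof.
move=> mf f0; have H := gprob_inhabited mu; rewrite (gintE H).
pose i : mtype H -> R := id.
have mi : measurable_fun setT i by move=> _ U mU; rewrite setTI.
rewrite [RHS](_ : _ = \int[pushforward (gpr H mu) i]_x f x)%E.
  by rewrite ge0_integral_pushforward// preimage_setT.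
exact: eq_measure_integral.
Qed.

(** The open left rays are closed under intersection, generate the Borel sets and exhaust the
    line. *)
Lemma gprob_line_eq mu nu :
  (forall t : R, mu `]-oo, t[%classic = nu `]-oo, t[%classic) -> mu = nu.
Proof.
move=> e; apply: gprobP => U mU.
apply: (@measure_unique _ _ _ (@RGenInftyO.G R)
  (fun n => `]-oo, n%:R[%classic) _ _ _ _ (gline mu) (gline nu)) => //.
- exact: RGenInftyO.measurableE.
- move=> _ _ [x ->] [y ->]; exists (Num.min x y).
  by apply/seteqP; split => z /=; rewrite !in_itv/= lt_min => /andP.
- by move=> n; eexists.
- apply/seteqP; split => // x _; exists (Num.truncn x).+1 => //=.
  by rewrite in_itv/= truncnS_gt.
- by move=> _ [t ->]; exact: e.
- move=> n; apply: (le_lt_trans (probability_le1 _ _)); last exact: ltry.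
  exact: measurable_itv.
Qed.

End gprob_on_the_line.

(** * The space of laws on the line as a measurable retract of the line *)

Section law_coding.
Variable R : realType.
Implicit Types (mu : gprob R (borel R)) (r t u : R).

Definition law_code mu : R :=
  bits_code R (fun i : rat * rat =>
    ((ratr i.1)%:E < mu `]-oo, (ratr i.2 : R)[%classic)%E).

(** Only rational levels are coded, so the real level [u] is tested through some rational [v > u].
    If [r] codes [mu], these are the rationals [q] with [u < mu(]-oo, q[)]. *)
Definition quantile_set r u : set rat :=
  [set q | exists2 v : rat, u < ratr v & bits_decode r (v, q)].

Definition law_quantile r u : R := rat_inf R (quantile_set r u).

Lemma measurable_law_code : @measurable_map (Giry R (borel R)) (borel R) law_code.
Proof.
have H : inhabited (gprob R (borel R)) by exact: inhabits (gdirac R (0 : borel R)).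
suff h : measurable_fun [set: @mtype (Giry R (borel R)) H]
    (law_code : @mtype (Giry R (borel R)) H -> R).
  by move=> U mU; have := h measurableT U mU; rewrite setTI.
apply: measurable_bits_code => -[v q] /=.
rewrite (_ : [set _ | _] = [set mu : gprob R (borel R) |
    (`](ratr v)%:E, +oo%E]%classic : set (\bar R))
      (mu `]-oo, (ratr q : R)[%classic)]).
  by apply: measurable_gev; [exact: measurable_itv|exact: emeasurable_itv].
by apply/funext => mu /=; rewrite in_itv/= leey andbT.
Qed.

Lemma measurable_law_quantile :
  measurable_fun [set: R * R] (fun z => law_quantile z.1 z.2).
Proof.
apply: measurable_rat_inf => q.
rewrite (_ : [set _ | _] = \bigcup_(v : rat) ((snd @^-1` `]-oo, ratr v[) `&`
    (fst @^-1` [set r | bits_decode r (v, q)]))).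
  apply: bigcupT_measurable_rat => v; apply: measurableI.
    by rewrite -[X in measurable X]setTI; exact: measurable_snd.
  rewrite -[X in measurable X]setTI; apply: measurable_fst => //.
  exact: measurable_bits_decode.
apply/seteqP; split=> z /=.
  by move=> [v uv b]; exists v => //; split => //=; rewrite in_itv.
by move=> [v _ [/=]]; rewrite in_itv/= => uv b; exists v.
Qed.

Lemma measurable_law_quantile_r r :
  @measurable_map (borel R) (borel R) (law_quantile r).
Proof.
move=> U mU.
have := measurableT_comp measurable_law_quantile (measurable_pair1 r).
by move=> /(_ measurableT U mU); rewrite setTI.
Qed.

Definition law_decode r : gprob R (borel R) :=
  gpush (MHom (@measurable_law_quantile_r r))
    (gprob_line (uniform_prob (@ltr01 R))).

(** The mass given to [U] is the uniform measure of the section at [r] of a single measurable subset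
    of the plane; hence the joint measurability of the quantile. *)
Lemma measurable_law_decode :
  @measurable_map (borel R) (Giry R (borel R)) law_decode.
Proof.
apply: measurable_to_Giry => U mU V mV.
have mA : measurable ((fun z : R * R => law_quantile z.1 z.2) @^-1` U).
  by rewrite -[X in measurable X]setTI; exact: measurable_law_quantile.
have := measurable_fun_xsection (uniform_prob (@ltr01 R)) mA.
move=> /(_ measurableT V mV); rewrite setTI; congr measurable.
apply/funext => r; rewrite /preimage /mkset /law_decode gpushE// gprob_lineE.
  rewrite /= (_ : xsection _ r = law_quantile r @^-1` U)//; apply/funext => u.
  by rewrite /xsection /=; apply/propext; rewrite inE.
exact: measurable_law_quantile_r.
Qed.

(** It suffices to compare rays. For [0 < u < 1] the quantile at [u] is below [t] exactly when
    [u < s], with [s] the mass of []-oo, t[], and the uniform mass of these [u] is [s]. *)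
Lemma law_codeK mu : law_decode (law_code mu) = mu.
Proof.
apply: gprob_line_eq => t.
have mray s : measurable (`]-oo, s[%classic : set R) by exact: measurable_itv.
rewrite /law_decode gpushE; last exact: mray.
rewrite gprob_lineE; last exact: (@measurable_law_quantile_r _ _ (mray t)).
have sE x : (fine (mu `]-oo, x[%classic))%:E = mu `]-oo, x[%classic.
  by apply: fineK; apply: (@fin_num_measure _ _ _ (gline mu)); exact: mray.
pose s := fine (mu `]-oo, t[%classic).
have s0 : 0 <= s by rewrite -lee_fin sE gmeas_ge0.
have s1 : s <= 1.
  by rewrite -lee_fin sE; apply: (@probability_le1 _ _ _ (gline mu)); exact: mray.
transitivity (uniform_prob (@ltr01 R) `]-oo, s[%classic); last first.
  rewrite uniform01E; last exact: mray.
  rewrite (_ : _ `&` _ = `[0, s[%classic).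
    rewrite lebesgue_measure_itv/= lte_fin oppr0 adde0 -sE -/s.
    by move: s0; rewrite le_eqVlt => /predU1P[<-|->//]; rewrite ltxx.
  by apply/seteqP; split => x /=; rewrite !in_itv/=; lra.
have qsE u q : quantile_set (law_code mu) u q <->
    (u%:E < mu `]-oo, (ratr q : R)[%classic)%E.
  rewrite /quantile_set /mkset /law_code; split => [[v uv]|].
    by rewrite bits_codeK; apply: lt_trans; rewrite lte_fin.
  rewrite -sE lte_fin => /rat_in_itvoo[v]; rewrite in_itv/= => /andP[uv vs].
  by exists v => //; rewrite bits_codeK/= -sE lte_fin.
apply: eq_uniform01 => [||u /andP[u0 u1]].
- exact: (@measurable_law_quantile_r _ _ (mray t)).
- exact: mray.
rewrite /= !in_itv/=.
(* [u < 1] makes the quantile set nonempty and [0 < u] bounds it below, so its infimum is finite. *)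
have [q0 uq0] : exists q, quantile_set (law_code mu) u q.
  have [|q uq] := @probability_ray_gt _ (gline mu) u%:E; first by rewrite lte_fin.
  by exists q; exact/qsE.
have [m mle] : exists m : R, forall q, quantile_set (law_code mu) u q -> m <= ratr q.
  have [|m mu_le] := @probability_ray_le _ (gline mu) u%:E; first by rewrite lte_fin.
  exists m => q /qsE; rewrite leNgt => uq; apply/negP => qm.
  move: uq; apply/negP; rewrite -leNgt; apply: le_trans mu_le.
  apply: (@le_measure _ _ _ (gline mu)); rewrite ?inE; try exact: mray.
  by move=> x /=; rewrite !in_itv/= => /lt_trans; exact.
have lawE := rat_inf_lt t (ex_intro _ _ uq0) mle.
rewrite -[u < s]lte_fin sE; split.
  move=> /lawE[q /qsE uq qt]; apply: (lt_le_trans uq).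
  apply: (@le_measure _ _ _ (gline mu)); rewrite ?inE; try exact: mray.
  by move=> x /=; rewrite !in_itv/= => /lt_trans; exact.
(* Left continuity replaces the real endpoint [t] by a rational one, as the code records rational
   endpoints only. *)
move=> /(@probability_ray_rat _ (gline mu))[q qt uq].
by apply/lawE; exists q => //; exact/qsE.
Qed.

End law_coding.

(** * Commutativity *)

Section pairing.
Variable R : realType.
Implicit Types (x : R * R) (r s : R).

(** Each coordinate is coded by its rational strict upper bounds, of which it is the infimum; the
    boolean selects the coordinate. *)
Definition pair_code x : R :=
  bits_code R (fun i : bool * rat => (if i.1 then x.1 else x.2) < ratr i.2).

Definition pair_decode (b : bool) r : R :=
  rat_inf R [set q | bits_decode r (b, q)].

Lemma pair_codeK b x : pair_decode b (pair_code x) = if b then x.1 else x.2.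
Proof.
rewrite -[RHS]rat_inf_gt; congr rat_inf; apply/funext => q.
by rewrite /mkset bits_codeK.
Qed.

Lemma measurable_pair_code : measurable_fun setT pair_code.
Proof.
apply: measurable_bits_code => -[b q]; rewrite -[X in measurable X]setTI.
pose f x := if b then x.1 else x.2.
rewrite (_ : [set _ | _] = f @^-1` `]-oo, ratr q[); last first.
  by apply/funext => x; rewrite /preimage /mkset in_itv.
have mf : measurable_fun setT f.
  by rewrite /f; case: (b); [exact: measurable_fst|exact: measurable_snd].
exact: mf.
Qed.

Lemma measurable_pair_decode b : measurable_fun setT (pair_decode b).
Proof. by apply: measurable_rat_inf => q; exact: measurable_bits_decode. Qed.

End pairing.

(** * Iterated binds as iterated integrals *)

Section gbind_fubini.
Variables (R : realType) (Z : mspace) (g : mhom (borel R) (Giry R Z)).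
Implicit Types (mu nu : gprob R (borel R)) (c : R * R -> R).

Lemma measurable_kernel c U : measurable_fun setT c -> msets U ->
  measurable_fun setT (fun x => g (c x) U).
Proof.
move=> mc mU; apply: (measurableT_comp (f := fun r => g r U)) mc => _ V mV.
by rewrite setTI; exact: (mfunctionP g (measurable_gev mU mV)).
Qed.

Definition section_mhom c (mc : measurable_fun setT c) r :
  mhom (borel R) (borel R) :=
  MHom (coding_fun_mhom (measurableT_comp mc (measurable_pair1 r))).

Lemma gbind_sectionE c (mc : measurable_fun setT c) nu r U : msets U ->
  gbind nu (mcomp g (section_mhom mc r)) U =
  (\int[gline nu]_s g (c (r, s)) U)%E.
Proof.
move=> mU; rewrite gbindE// gint_gline//.
- by apply: (measurableT_comp (measurable_kernel mc mU)); exact: measurable_pair1.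
- by move=> s; exact: gmeas_ge0.
Qed.

Lemma measurable_gbind_section c (mc : measurable_fun setT c) nu :
  @measurable_map (borel R) (Giry R Z)
    (fun r => gbind nu (mcomp g (section_mhom mc r))).
Proof.
apply: measurable_to_Giry => U mU V mV.
have := measurable_fun_fubini_tonelli_F (m2 := gline nu) _
  (measurable_kernel mc mU) (fun x => gmeas_ge0 _ U).
move=> /(_ measurableT V mV); rewrite setTI; congr measurable.
by apply/funext => r; rewrite /preimage /mkset gbind_sectionE.
Qed.

Definition gbind_section c (mc : measurable_fun setT c) nu :
  mhom (borel R) (Giry R Z) := MHom (measurable_gbind_section mc nu).

Lemma gbind_gbind_sectionE c (mc : measurable_fun setT c) mu nu U : msets U ->
  gbind mu (gbind_section mc nu) U =
  (\int[gline mu]_r \int[gline nu]_s g (c (r, s)) U)%E.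
Proof.
move=> mU; rewrite gbindE// gint_gline.
- by apply: eq_integral => r _; exact: gbind_sectionE.
- move=> _ V mV; rewrite setTI.
  exact: (mfunctionP (gbind_section mc nu) (measurable_gev mU mV)).
- by move=> r; exact: gmeas_ge0.
Qed.

(** Fubini-Tonelli for [(r, s) |-> g (c (r, s)) U]. The general [c] lets both [pair_code] and its
    version with exchanged arguments be used. *)
Lemma gbind_section_swap c (mc : measurable_fun setT c)
    (mc' : measurable_fun setT (fun x => c (x.2, x.1))) mu nu :
  gbind mu (gbind_section mc nu) = gbind nu (gbind_section mc' mu).
Proof.
apply: gprobP => U mU; rewrite !gbind_gbind_sectionE//.
apply: (fubini_tonelli (fun x => g (c x) U)); first exact: measurable_kernel.
by move=> x; exact: gmeas_ge0.
Qed.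

End gbind_fubini.

(** * Functorial action and commutativity of [P] *)

Section P_monad.
Variable R : realType.
Implicit Types X Y Z : qbs R.

Lemma gbind_unit (Z : mspace) (mu : gprob R Z) :
  gbind mu (Giry_unit R Z) = mu.
Proof.
apply: gprobP => U mU; rewrite gbindE//.
have H := gprob_inhabited mu; rewrite (gintE H).
rewrite (eq_integral (fun x : mtype H => (\1_U x)%:E)); last first.
  by move=> x _; exact: gdiracE.
have mHU : measurable (U : set (mtype H)) by [].
by rewrite (integral_indic (gpr H mu) measurableT mHU) setIT.
Qed.

(** The unit at [f (a r)] is the class of [f \o a] with the Dirac law at [r], so the bind uses the
    Dirac kernel, which leaves [mu] unchanged. *)
Lemma P_map_qclass X Y (f : qhom X Y) (a : relt X) (mu : gprob R (borel R)) :
  P_map f (qclass a mu) = qclass (relt_map f a) mu.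
Proof.
rewrite -[in RHS](gbind_unit mu); apply: P_bindE => r /=.
apply/qclassP/gprobP => U mU.
rewrite !gpushE// !gdiracE//.
  exact: (mfunctionP (relt_mhom (relt_map f a)) mU).
exact: (mfunctionP (relt_mhom (relt_cst (f (a r)))) mU).
Qed.

(** Decoding a real into two and applying [a] and [b] gives one random element of the product; its
    image under [f] is then evaluated at codes of pairs. *)
Lemma qprod_kernel X Y Z (f : qhom (qprod X Y) (P Z)) (a : relt X) (b : relt Y) :
  exists (c : relt Z) (g : mhom (borel R) (Giry R (borel R))),
    forall r s, f (a r, b s) = qclass c (g (pair_code (r, s))).
Proof.
have Mab : qrelts (q := qprod X Y)
    (fun t => (a (pair_decode true t), b (pair_decode false t))).
  by split; [apply: (qrelts_comp (rfunP a))|apply: (qrelts_comp (rfunP b))];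
    exact: measurable_pair_decode.
have [[c g] fE] := qfunP f Mab.
by exists c, g => r s; have := fE (pair_code (r, s)); rewrite /= !pair_codeK.
Qed.

Lemma P_bind_commutes X Y Z (p : P X) (q : P Y) (f : qhom (qprod X Y) (P Z)) :
  exists (u : qhom X (P Z)) (v : qhom Y (P Z)),
    [/\ forall x : X, u x = P_bind q (qcurry f x),
        forall y : Y, v y = P_bind p (qcurry_swap f y)
      & P_bind p u = P_bind q v].
Proof.
rewrite -(P_reprK p) -(P_reprK q).
move: (qrv (P_repr p)) (qlaw (P_repr p)) => a mu.
move: (qrv (P_repr q)) (qlaw (P_repr q)) => b nu.
have mc := @measurable_pair_code R.
have mc' : measurable_fun setT (fun x : R * R => pair_code (x.2, x.1)).
  by apply: (measurableT_comp mc); apply: measurable_fun_pair.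
(* All random elements [a'] are covered: they show that the partial bind is a morphism, and [a' = a]
   enters the final equality. *)
have uE (a' : relt X) c (g : mhom (borel R) (Giry R (borel R))) :
    (forall r s, f (a' r, b s) = qclass c (g (pair_code (r, s)))) ->
    forall r, P_bind (qclass b nu) (qcurry f (a' r)) =
              qclass c (gbind_section g mc nu r).
  by move=> fE r; apply: P_bindE => s; exact: fE.
have vE (b' : relt Y) c (g : mhom (borel R) (Giry R (borel R))) :
    (forall r s, f (a r, b' s) = qclass c (g (pair_code (r, s)))) ->
    forall s, P_bind (qclass a mu) (qcurry_swap f (b' s)) =
              qclass c (gbind_section g mc' mu s).
  by move=> fE s; apply: P_bindE => r; exact: fE.
have Mu (a' : R -> X) : qrelts a' ->
    qrelts ((fun x => P_bind (qclass b nu) (qcurry f x)) \o a').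
  move=> Ma'; have [c [g fE]] := qprod_kernel f (Relt Ma') b.
  by exists (c, gbind_section g mc nu) => r; exact: (uE (Relt Ma')).
have Mv (b' : R -> Y) : qrelts b' ->
    qrelts ((fun y => P_bind (qclass a mu) (qcurry_swap f y)) \o b').
  move=> Mb'; have [c [g fE]] := qprod_kernel f a (Relt Mb').
  by exists (c, gbind_section g mc' mu) => s; exact: (vE (Relt Mb')).
exists (QHom Mu), (QHom Mv); split => //.
(* The same [c] and [g] serve both sides, which then differ only in the order of integration. *)
have [c [g fE]] := qprod_kernel f a b.
rewrite (@P_bindE _ _ _ (QHom Mu) _ mu _ _ (uE a c g fE)).
rewrite (@P_bindE _ _ _ (QHom Mv) _ nu _ _ (vE b c g fE)).
by congr qclass; exact: gbind_section_swap.
Qed.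

(** * The map [l] to the Giry monad *)

Lemma l_P_unit X (x : X) : l X (P_unit X x) = gdirac R (x : L X).
Proof.
transitivity (gpush (relt_mhom (relt_cst x)) (gdirac R (0 : borel R))).
  exact: l_funE.
apply: gprobP => U mU; rewrite gpushE// !gdiracE//.
exact: (mfunctionP (relt_mhom (relt_cst x)) mU).
Qed.

Lemma l_P_bind X Y (f : qhom X (P Y)) (t : P X) :
  l Y (P_bind t f) = gbind (l X t) (Kleisli_L f).
Proof.
rewrite -[in RHS](P_reprK t) /P_bind; case: cid => -[b g] /= fE.
exact: l_gbind.
Qed.

(* Every mu is l [h, f_* mu].  The inverse of l is measurable because it factors
   through [law_code], and r |-> [h, law_decode r] is a random element of P X. *)
Lemma l_iso_of_retract X (f : mhom (L X) (borel R)) (h : relt X) :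
  cancel f h -> measurable_iso (l X).
Proof.
move=> fK; split; first exact: (@mfunctionP _ _ (l X)).
pose k mu : P X := qclass h (gpush f mu).
have kK : cancel k (l X).
  move=> mu; transitivity (gpush (relt_mhom h) (gpush f mu)); first exact: l_funE.
  apply: gprobP => U mU; rewrite !gpushE//.
    by congr (gmeas mu _); apply/funext => x; rewrite /preimage /mkset/= fK.
  exact: (mfunctionP (relt_mhom h) mU).
exists k; split => [U mU| t|//]; last first.
  by apply: l_fun_inj; exact: kK.
have Ms : qrelts (q := P X) (fun r => qclass h (law_decode r)).
  by exists (h, MHom (@measurable_law_decode R)).
have := measurable_gpush f (@measurable_law_code R _ (mU _ Ms)).
by congr msets; apply/funext => mu; rewrite /preimage /mkset /k law_codeK.
Qed.

(** An inhabited standard Borel space is a measurable retract of the line: by the given isomorphism,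
    or by sending the points of a countable space to distinct cells. *)
Lemma l_iso_standard_borel (Z : mspace) :
  standard_borel R Z -> measurable_iso (l (qbs_of R Z)).
Proof.
have msetsL (U : set Z) : msets U -> @msets (L (qbs_of R Z)) U.
  by move=> mU a Ma; exact: Ma.
case=> [[f [mf [h [mh fK _]]]]|[cZ dZ]].
  pose f' : mhom (L (qbs_of R Z)) (borel R) :=
    @MHom (L (qbs_of R Z)) _ f (fun U mU => msetsL _ (mf U mU)).
  exact: (@l_iso_of_retract _ f' (@Relt _ (qbs_of R Z) h mh)).
(* Over the empty space there are no probability measures, so source and target of [l] are both
   empty. *)
have [[z0]|Z0] := pselect (inhabited Z); last first.
  split; first exact: (@mfunctionP _ _ (l (qbs_of R Z))).
  have nP (mu : gprob R (L (qbs_of R Z))) : False.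
    by apply: Z0; exact: (gprob_inhabited mu).
  exists (fun mu => False_rect _ (nP mu)); split.
  - move=> U _; rewrite (_ : _ @^-1` _ = set0); first exact: msets0.
    by apply/seteqP; split => // mu; case: (nP mu).
  - by move=> t; case: (nP (l _ t)).
  - by move=> mu; case: (nP mu).
move/countable_injP : cZ => [n n_inj].
have nI : injective n by move=> x y; apply: n_inj; rewrite inE.
(* [m] is a left inverse of the enumeration [n], with value [z0] available off its image. *)
have /choice[m mE] : forall i, exists z' : Z, forall z, n z = i -> z' = z.
  move=> i.
  have [[z zi]|nz] := pselect (exists z, n z = i).
    by exists z => z' z'i; apply: nI; rewrite zi.
  by exists z0 => z zi; case: nz; exists z.
pose i r := Num.truncn ((r + 1) / 2 : R).
have mh : @measurable_map (borel R) Z (m \o i).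
  move=> U _; rewrite (_ : _ @^-1` _ = \bigcup_(j in m @^-1` U) @cell R j).
    by apply: bigcup_measurable => j _; exact: measurable_cell.
  by apply/seteqP; split => [r mU|r [j mU rj]]; [exists (i r)|rewrite /= /i rj].
pose f : mhom (L (qbs_of R Z)) (borel R) :=
  @MHom (L (qbs_of R Z)) (borel R) (fun z => Defs.code (n z) (0 : R))
    (fun U _ => msetsL _ (dZ _)).
apply: (@l_iso_of_retract _ f (@Relt _ (qbs_of R Z) (m \o i) mh)) => z /=.
by rewrite /i (cell_code (n z) (0 : R)); exact: mE.
Qed.

End P_monad.

Theorem proposition22 (R : realType) :
  [/\
    (* 1. functorial action *)
    forall (X Y : qbs R) (f : qhom X Y) (a : relt X) (mu : gprob R (borel R)),
      P_map f (qclass a mu) = qclass (relt_map f a) mu,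

    (* 2. commutativity; u and v are the morphisms
       fun x => (q >>= fun y => f (x, y)) and fun y => (p >>= fun x => f (x, y)) *)
    forall (X Y Z : qbs R) (p : P X) (q : P Y) (f : qhom (qprod X Y) (P Z)),
      exists (u : qhom X (P Z)) (v : qhom Y (P Z)),
        [/\ forall x : X, u x = P_bind q (qcurry f x),
            forall y : Y, v y = P_bind p (qcurry_swap f y)
          & P_bind p u = P_bind q v],

    (* 3. *)
    [/\
      (* L is a faithful functor *)
      [/\ forall X : qbs R, L_map (qid X) = mid (L X),
          forall (X Y Z : qbs R) (g : qhom Y Z) (f : qhom X Y),
            L_map (qcomp g f) = mcomp (L_map g) (L_map f)
        & forall (X Y : qbs R) (f g : qhom X Y), L_map f = L_map g -> f = g],

      (* (L, l) is a monad opfunctor from P to G *)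
      [/\ forall (X : qbs R) (a : relt X) (mu : gprob R (borel R)),
            l X (qclass a mu) = gpush (relt_mhom a) mu,
          forall X : qbs R, @measurable_map (L (P X)) (Giry R (L X)) (l X),
          forall X : qbs R,
            mcomp (l X) (L_map (P_unit X)) = Giry_unit R (L X)
        & forall (X Y : qbs R) (f : qhom X (P Y)) (t : P X),
            l Y (P_bind t f) = gbind (l X t) (mcomp (l Y) (L_map f))]

      (* f |-> l o L f is a faithful functor Kleisli(P) -> Kleisli(G)
         extending L *)
    & [/\ forall X : qbs R, Kleisli_L (P_unit X) = Giry_unit R (L X),
          forall (X Y Z : qbs R) (g : qhom Y (P Z)) (f : qhom X (P Y)),
            Kleisli_L (P_kcomp g f) = Giry_kcomp (Kleisli_L g) (Kleisli_L f),
          forall (X Y : qbs R) (f : qhom X Y),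
            Kleisli_L (qcomp (P_unit Y) f) =
            mcomp (Giry_unit R (L Y)) (L_map f)
        & forall (X Y : qbs R) (f g : qhom X (P Y)),
            Kleisli_L f = Kleisli_L g -> f = g]]

    (* 4. standard Borel spaces *)
  & forall Z : mspace, standard_borel R Z -> measurable_iso (l (qbs_of R Z))].
Proof.
split; first exact: P_map_qclass.
- exact: P_bind_commutes.
- split; split.
  + by move=> X; exact: mhomP.
  + by move=> X Y Z g f; exact: mhomP.
  + by move=> X Y f g fg; apply: qhomP => x;
    exact: (congr1 (fun h : mhom (L X) (L Y) => h x) fg).
  + by move=> X a mu; exact: l_funE.
  + exact: measurable_l.
  + by move=> X; apply: mhomP => x; exact: l_P_unit.
  + exact: l_P_bind.
  + by move=> X; apply: mhomP => x; exact: l_P_unit.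
  + by move=> X Y Z g f; apply: mhomP => x; exact: l_P_bind.
  + by move=> X Y f; apply: mhomP => x; exact: l_P_unit.
  (* Faithfulness is the injectivity of [l], since classes are identified exactly when their
     pushforwards agree. *)
  + move=> X Y f g fg; apply: qhomP => x; apply: l_fun_inj.
    exact: (congr1 (fun h : mhom (L X) (Giry R (L Y)) => h x) fg).
- exact: l_iso_standard_borel.
Qed.
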